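(* The following two statements are equivalent: (1) for every $n\in\mathbb{N}$ and every stream $s$, $\mathit{le}_n\,s$ implies $\mathcal{F}\,(\mathcal{G}\,\mathit{blue})\,s$; (2) for every stream $s$, $\mathcal{F}\,\mathit{red}\,s\ \vee\ \mathcal{G}\,\mathit{blue}\,s$ (this is LPO).
   Context: The equivalence is to be proved constructively (intuitionistic type theory with inductive and coinductive definitions; no excluded middle, no Markov's principle). A color is one of $R$ (red), $B$ (blue). A stream is an element of the coinductive type whose only constructor forms $c\,s$ from a color $c$ and a stream $s$; streams are considered up to bisimilarity (equivalently, functions $\mathbb{N}\to\{R,B\}$ up to pointwise equality). $\mathit{red}\,s$ means $s=R\,s'$ for some $s'$; $\mathit{blue}\,s$ means $s=B\,s'$ for some $s'$. For a stream predicate $X$: $\mathcal{F}\,X$ is defined inductively by the rules: $X\,s$ implies $\mathcal{F}\,X\,s$; $\mathcal{F}\,X\,s$ implies $\mathcal{F}\,X\,(c\,s)$ for any color $c$. $\mathcal{G}\,X$ is defined coinductively by the rule: $X\,(c\,s)$ and $\mathcal{G}\,X\,s$ imply $\mathcal{G}\,X\,(c\,s)$. The relation $\mathit{le}_n\,s$ (''$s$ has fewer than $n$ red positions'') is defined coinductively by the rules: $\mathit{le}_{n+1}\,s$ implies $\mathit{le}_{n+1}\,(B\,s)$; $\mathit{le}_n\,s$ implies $\mathit{le}_{n+1}\,(R\,s)$. There is no rule for $\mathit{le}_0$, so $\mathit{le}_0\,s$ is always false. *)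

(* Defs.v *)
(* Standard library only. All predicates live in Prop, and this file assumes no axiom. *)

Inductive color : Set := R | B.

CoInductive stream : Set := Cons : color -> stream -> stream.

CoInductive bisim : stream -> stream -> Prop :=
| bisim_Cons c s t : bisim s t -> bisim (Cons c s) (Cons c t).

Definition red (s : stream) : Prop := exists s', s = Cons R s'.

Definition blue (s : stream) : Prop := exists s', s = Cons B s'.

Inductive F (X : stream -> Prop) : stream -> Prop :=
| F_now s : X s -> F X s
| F_later c s : F X s -> F X (Cons c s).

CoInductive G (X : stream -> Prop) : stream -> Prop :=
| G_Cons c s : X (Cons c s) -> G X s -> G X (Cons c s).

(* [le_red n s]: s has fewer than n red positions. *)
CoInductive le_red : nat -> stream -> Prop :=
| le_red_B n s : le_red (S n) s -> le_red (S n) (Cons B s)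
| le_red_R n s : le_red n s -> le_red (S n) (Cons R s).

(* The definitions above use Leibniz equality of streams.  The following lemmas
   show that they nevertheless depend on streams only up to bisimilarity. *)

Definition respects_bisim (X : stream -> Prop) : Prop :=
  forall s t, bisim s t -> X s -> X t.

Lemma red_bisim : respects_bisim red.
Proof.
  intros s t H [s' ->]. inversion H; subst. eexists; reflexivity.
Qed.

Lemma blue_bisim : respects_bisim blue.
Proof.
  intros s t H [s' ->]. inversion H; subst. eexists; reflexivity.
Qed.

Lemma F_bisim X : respects_bisim X -> respects_bisim (F X).
Proof.
  intros HX s t H HF. revert t H.
  induction HF as [s Hs | c s HF IH]; intros t H.
  - apply F_now. exact (HX _ _ H Hs).
  - inversion H; subst. apply F_later, IH. assumption.
Qed.

Lemma G_bisim X : respects_bisim X -> respects_bisim (G X).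
Proof.
  intros HX. cofix IH. intros s t H HG.
  destruct H as [c s t H]. constructor.
  - apply (HX (Cons c s)); [constructor; exact H | inversion HG; assumption].
  - apply (IH s t H). inversion HG; assumption.
Qed.

Lemma le_red_bisim n : respects_bisim (le_red n).
Proof.
  revert n. cofix IH. intros n s t H HL.
  destruct HL as [n s HL | n s HL]; inversion H; subst; constructor;
    (eapply IH; [eassumption | exact HL]).
Qed.

(* Main.v *)
(** The proof is constructive. For (1) => (2), erase every red position of [s]
    after the first one: the result has fewer than two red positions, so it is
    eventually all blue, and the finite prefix given by (1) can be searched for
    the first red position of [s]. For (2) => (1), induct on [n]: LPO either
    says that [s] is all blue or locates a red position, beyond which the bound
    has dropped by one. *)

Require Import Defs.

CoFixpoint all_blue : stream := Cons B all_blue.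

CoFixpoint keep_first_red (s : stream) : stream :=
  match s with
  | Cons R _ => Cons R all_blue
  | Cons B s' => Cons B (keep_first_red s')
  end.

(** The match forces a cofixpoint to reduce one step, so the unfolding equations below are instances
    up to conversion. *)
Lemma stream_eta (s : stream) : s = match s with Cons c s' => Cons c s' end.
Proof. destruct s; reflexivity. Qed.

Lemma all_blue_unfold : all_blue = Cons B all_blue.
Proof. exact (stream_eta all_blue). Qed.

Lemma keep_first_red_R (s : stream) :
  keep_first_red (Cons R s) = Cons R all_blue.
Proof. exact (stream_eta (keep_first_red (Cons R s))). Qed.

Lemma keep_first_red_B (s : stream) :
  keep_first_red (Cons B s) = Cons B (keep_first_red s).
Proof. exact (stream_eta (keep_first_red (Cons B s))). Qed.

Lemma le_red_all_blue (n : nat) : le_red (S n) all_blue.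
Proof. cofix IH. rewrite all_blue_unfold. constructor. exact IH. Qed.

Lemma le_red_keep_first_red (s : stream) : le_red 2 (keep_first_red s).
Proof.
  revert s. cofix IH. intros [[|] s].
  - rewrite keep_first_red_R. constructor. apply le_red_all_blue.
  - rewrite keep_first_red_B. constructor. apply IH.
Qed.

(** The first red position survives the erasure, so an all-blue result leaves no room for one. *)
Lemma G_blue_keep_first_red (s : stream) :
  G blue (keep_first_red s) -> G blue s.
Proof.
  revert s. cofix IH. intros [[|] s] H.
  - exfalso. rewrite keep_first_red_R in H.
    inversion H as [c t [u Hu] _]. discriminate Hu.
  - constructor.
    + exists s. reflexivity.
    + apply IH. rewrite keep_first_red_B in H. inversion H. assumption.
Qed.

(** Induction on the [F] derivation is the bounded search: it stops at a red head of [s] or at an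
    all-blue tail. *)
Lemma F_G_blue_keep_first_red (s : stream) :
  F (G blue) (keep_first_red s) -> F red s \/ G blue s.
Proof.
  intros H. remember (keep_first_red s) as t eqn:Et. revert s Et.
  induction H as [t Ht | c t _ IH]; intros s Et.
  - right. apply G_blue_keep_first_red. rewrite <- Et. exact Ht.
  - destruct s as [[|] s].
    + left. apply F_now. exists s. reflexivity.
    + rewrite keep_first_red_B in Et. injection Et as _ Et.
      destruct (IH s Et) as [Hr | Hb].
      * left. apply F_later. exact Hr.
      * right. constructor; [exists s; reflexivity | exact Hb].
Qed.

Lemma F_G_blue_of_F_red (n : nat) (s : stream) :
  (forall t, le_red n t -> F (G blue) t) ->
  F red s -> le_red (S n) s -> F (G blue) s.
Proof.
  intros IHn H. induction H as [s [t ->] | c s _ IH]; intros Hle.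
  - apply F_later, IHn. inversion Hle. assumption.
  (* [c] may be red, as [F red] need not stop at the first red: then the bound drops and [IHn]
     applies; if blue, [IH] does. *)
  - apply F_later. inversion Hle; auto.
Qed.

Theorem lemma4p7 :
  (forall (n : nat) (s : stream), le_red n s -> F (G blue) s)
  <->
  (forall s : stream, F red s \/ G blue s).
Proof.
  split.
  - intros H s. apply F_G_blue_keep_first_red.
    exact (H 2 _ (le_red_keep_first_red s)).
  - intros LPO n. induction n as [|n IHn]; intros s Hle.
    + inversion Hle.
    + destruct (LPO s) as [Hr | Hb].
      * exact (F_G_blue_of_F_red n s IHn Hr Hle).
      * apply F_now. exact Hb.
Qed.
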